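(* For every $n\ge 1$, every word $w$ of length $n$ over an alphabet $\Sigma$ satisfies $SP(w)\le F_{n+2}-1$, where $F_k$ denotes the $k$-th Fibonacci number ($F_1=F_2=1$, $F_k=F_{k-1}+F_{k-2}$ for $k\ge 3$).
   Context: A word $u$ is a scattered subword of $w$ if $u$ is a (not necessarily contiguous) subsequence of $w$. A palindrome is a word equal to its reversal. $SP(w)$ denotes the number of distinct non-empty palindromes that are scattered subwords of $w$. *)

(* Defs.v *)
From mathcomp Require Import all_boot.

Set Implicit Arguments.
Unset Strict Implicit.
Unset Printing Implicit Defensive.

Fixpoint fib (n : nat) : nat :=
  if n is n'.+1 then (if n' is n''.+1 then fib n' + fib n'' else 1) else 0.

Definition palindrome (Sigma : eqType) (u : seq Sigma) : bool := u == rev u.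

(* The scattered subwords of w are the words mask m w for m ranging over the
   bit vectors of length size w, cf. subseqP; several masks can yield the same
   word, and undup removes the repetitions. *)
Definition scattered_palindromes (Sigma : eqType) (w : seq Sigma) :
    seq (seq Sigma) :=
  undup [seq u <- [seq mask (val m) w | m : (size w).-tuple bool]
        | (u != [::]) && palindrome u].

Definition SP (Sigma : eqType) (w : seq Sigma) : nat :=
  size (scattered_palindromes w).

Lemma mem_scattered_palindromes (Sigma : eqType) (w u : seq Sigma) :
  (u \in scattered_palindromes w) =
  [&& subseq u w, u != [::] & palindrome u].
Proof.
rewrite mem_undup mem_filter andbC; congr (_ && _).
apply/mapP/subseqP => [[m _ ->]|[m sz_m ->]].
  by exists (val m); rewrite // size_tuple.
move/eqP: sz_m => sz_m.
by exists (Tuple sz_m); rewrite ?mem_enum.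
Qed.

Lemma uniq_scattered_palindromes (Sigma : eqType) (w : seq Sigma) :
  uniq (scattered_palindromes w).
Proof. exact: undup_uniq. Qed.

Lemma fibSS (n : nat) : fib n.+2 = fib n.+1 + fib n.
Proof. by []. Qed.

(* Main.v *)
(** Count the empty word as well and show that a word [w] has at most
    [fib (size w).+2] palindromic scattered subwords, by induction on its
    length.  Write [w = a t].  A palindromic subword of [w] that is not one of
    [t] begins, hence also ends, with [a].  If [a] does not occur in [t], it is
    the word [a].  Otherwise it is [a v a] with [v] a palindromic subword of the
    part of [t] that precedes the last [a] of [t].  There are therefore at most
    [fib (size w).+1 + fib (size w)] possibilities. *)

Require Import Defs.
From mathcomp Require Import all_boot.

Set Implicit Arguments.
Unset Strict Implicit.
Unset Printing Implicit Defensive.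

Lemma leq_fib (m n : nat) : m <= n -> fib m <= fib n.
Proof.
apply: (homo_leq leqnn leq_trans) => -[|i] //.
by rewrite fibSS leq_addr.
Qed.

Section PalindromicSubwords.

Variable Sigma : eqType.
Implicit Types (a : Sigma) (s t u v w : seq Sigma).

Lemma palindrome_cons_inv a u :
  palindrome (a :: u) -> u = [::] \/ exists2 v, palindrome v & u = rcons v a.
Proof.
rewrite /palindrome; case/lastP: u => [|v b]; first by left.
rewrite rev_cons rev_rcons rcons_cons eqseq_cons eqseq_rcons.
by case/and3P => /eqP-> pal_v _; right; exists v.
Qed.

(** Greedy matching: sending the leading [a] to its first occurrence in [t] leaves the longest
    suffix for [s]. *)
Lemma subseq_cons_drop a s t :
  subseq (a :: s) t -> subseq s (drop (index a t).+1 t).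
Proof.
elim: t => //= b t IHt; rewrite eq_sym.
by case: eqP => [_|_ /IHt]; rewrite ?drop0.
Qed.

(** Empty when [a] does not occur in [t]. *)
Definition before_last a t : seq Sigma :=
  rev (drop (index a (rev t)).+1 (rev t)).

Lemma size_before_last a t : size (before_last a t) <= (size t).-1.
Proof.
by rewrite size_rev size_drop size_rev subnS -!subn1 leq_sub2r // leq_subr.
Qed.

Lemma subseq_rcons_before_last a v t :
  subseq (rcons v a) t -> subseq v (before_last a t).
Proof.
rewrite -subseq_rev rev_rcons => /subseq_cons_drop.
by rewrite -[X in subseq _ X]revK subseq_rev.
Qed.

(** The inner word comes out reversed, which is harmless for palindromes; a single letter gives
    [[::]]. *)
Definition trim u : seq Sigma := behead (rev (behead u)).

(** With [a] and [t] fixed, the last clause recovers [u] from [trim u], so [trim] is injective on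
    the new palindromes. *)
Lemma new_palindromeP a t u :
    subseq u (a :: t) -> palindrome u -> ~~ subseq u t ->
  [/\ palindrome (trim u), subseq (trim u) (before_last a t)
    & u = if a \in t then a :: rcons (trim u) a else [:: a]].
Proof.
case: u => [|b u]; first by rewrite !sub0seq.
rewrite /=; case: eqP => [->|_ -> //] sub_ut pal_u.
case: (palindrome_cons_inv pal_u) sub_ut => [->|[v pal_v ->]].
  by rewrite sub1seq => _ /negPf->; split=> //; apply: sub0seq.
have -> : trim (a :: rcons v a) = v.
  by rewrite /trim /= rev_rcons /=; apply/esym/eqP.
move=> sub_vat _; split=> //; first exact: subseq_rcons_before_last.
by rewrite (mem_subseq sub_vat) // mem_rcons mem_head.
Qed.

Lemma size_palindromic_subwords w (ps : seq (seq Sigma)) :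
    uniq ps -> {in ps, forall u, palindrome u && subseq u w} ->
  size ps <= fib (size w).+2.
Proof.
(* Strong induction: the bound is applied both to [t] and to the shorter [before_last a t]. *)
have [n le_wn] := ubnP (size w); elim: n w le_wn ps => // n IHn [|a t] le_wn ps.
  move=> uniq_ps psP; apply: (@uniq_leq_size _ ps [:: [::]]) => // u /psP.
  by rewrite subseq0 mem_seq1 => /andP[].
move=> uniq_ps psP; rewrite [size (a :: t)]/= fibSS.
rewrite -(count_predC (subseq^~ t) ps) -!size_filter leq_add //.
  apply: IHn => //; first exact: filter_uniq.
  by move=> u; rewrite mem_filter => /andP[-> /psP/andP[->]].
set new := filter _ ps.
have newP u : u \in new ->
    [/\ palindrome (trim u), subseq (trim u) (before_last a t)
      & u = if a \in t then a :: rcons (trim u) a else [:: a]].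
  rewrite mem_filter => /andP[/= nsub /psP/andP[pal sub]].
  exact: new_palindromeP.
have uniq_new : uniq (map trim new).
  rewrite map_inj_in_uniq ?filter_uniq // => u v /newP[_ _ ->] /newP[_ _ ->].
  by case: (a \in t) => //=; rewrite /trim /= !rev_rcons /= => /(can_inj revK)->.
rewrite -(size_map trim) (@leq_trans (fib (size (before_last a t)).+2)) //.
  apply: IHn uniq_new _ => [|_ /mapP[u /newP[pal sub _] ->]]; last exact/andP.
  apply: leq_ltn_trans (size_before_last a t) _.
  exact: leq_ltn_trans (leq_pred (size t)) _.
have := size_before_last a t.
(* For empty [t] the predecessor truncates to 0, and the bound rests on [fib 2 = fib 1] instead of
   monotonicity. *)
case: (size t) => [|m] le_m; last exact: leq_fib.
by move: le_m; rewrite leqn0 => /eqP->.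
Qed.

End PalindromicSubwords.

Theorem theorem4p2 (Sigma : eqType) (n : nat) (hn : 1 <= n)
  (w : seq Sigma) (hw : size w = n) :
  SP w <= fib (n + 2) - 1.
Proof.
rewrite -hw addn2 leq_subRL ?(leq_fib (isT : 1 < (size w).+2)) //.
(* The 1 moved across the inequality counts the empty word. *)
rewrite add1n -[(SP w).+1]/(size ([::] :: scattered_palindromes w)).
apply: size_palindromic_subwords => [|u].
  by rewrite /= uniq_scattered_palindromes mem_scattered_palindromes /= andbF.
rewrite in_cons mem_scattered_palindromes.
by case/predU1P => [->|/and3P[-> _ ->]]; rewrite ?sub0seq.
Qed.
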